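(* $\mathrm{CL}_{\mathbb{N}^\mathbb{N}}\equiv_{sW}\mathrm{C}_{\mathbb{N}^\mathbb{N}}'\equiv_{sW}\mathrm{C}_{\mathbb{N}^\mathbb{N}}$.
   Context: A representation of a set $X$ is a surjective partial function $\delta:\subseteq\mathbb{N}^\mathbb{N}\to X$. For $f:\subseteq(X,\delta_X)\rightrightarrows(Y,\delta_Y)$ a realizer is a single-valued partial $F:\subseteq\mathbb{N}^\mathbb{N}\to\mathbb{N}^\mathbb{N}$ with $\delta_Y(F(p))\in f(\delta_X(p))$ for all $p\in\mathrm{dom}(f\circ\delta_X)$ ($F\vdash f$). $f\le_{sW}g$ iff there are computable partial $H,K$ on Baire space with $H\circ G\circ K\vdash f$ for every $G\vdash g$; $\equiv_{sW}$ is mutual reducibility. Baire space $\mathbb{N}^\mathbb{N}$ is considered as a computable metric space with metric $d(p,q)=2^{-\min\{i:p(i)\neq q(i)\}}$ ($d(p,p)=0$) and a standard computable dense sequence $\alpha$ of eventually-zero sequences; it is represented (equivalently to its Cauchy representation) by the identity. $(\mathbb{N}^\mathbb{N})^\mathbb{N}$ is represented by $\langle p_0,p_1,\ldots\rangle\mapsto(p_0,p_1,\ldots)$, where $\langle p_0,p_1,\ldots\rangle(\langle i,j\rangle)=p_i(j)$ for a standard computable pairing. With $(q_k)$ a standard enumeration of non-negative rationals and $B_{\langle i,k\rangle}=\{x:d(\alpha(i),x)<q_k\}$, closed sets $A\subseteq\mathbb{N}^\mathbb{N}$ are represented by $\psi_-(p)=\mathbb{N}^\mathbb{N}\setminus\bigcup_iB_{p(i)}$.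 Closed choice $\mathrm{C}_{\mathbb{N}^\mathbb{N}}$ maps a non-empty closed set $A$ (given via $\psi_-$) to any element of $A$. $\mathrm{CL}_{\mathbb{N}^\mathbb{N}}$ maps a sequence in $\mathbb{N}^\mathbb{N}$ having at least one cluster point to any of its cluster points. $\lim:\subseteq\mathbb{N}^\mathbb{N}\to\mathbb{N}^\mathbb{N}$ maps $\langle p_0,p_1,\ldots\rangle$ to $\lim_ip_i$ whenever it exists. The derivative $f'$ of $f:\subseteq(X,\delta)\rightrightarrows Y$ is the same function with input representation $\delta\circ\lim$ in place of $\delta$. *)

(* Defs.v *)
From Stdlib Require Import Rdefinitions.
From Stdlib Require Cantor.
From mathcomp Require Import all_boot all_order all_algebra.
From mathcomp Require Import boolp classical_sets reals Rstruct.

Set Implicit Arguments.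
Unset Strict Implicit.
Unset Printing Implicit Defensive.

Import Order.TTheory GRing.Theory Num.Theory.

Local Open Scope classical_set_scope.
Local Open Scope ring_scope.

Definition baire : Type := nat -> nat.

Definition pairing (i j : nat) : nat := Cantor.to_nat (i, j).
Definition unpairing (n : nat) : nat * nat := Cantor.of_nat n.

Lemma pairingK i j : unpairing (pairing i j) = (i, j).
Proof. exact: Cantor.cancel_of_to. Qed.

Lemma unpairingK n : pairing (unpairing n).1 (unpairing n).2 = n.
Proof. by rewrite /pairing -surjective_pairing; exact: Cantor.cancel_to_of. Qed.

(* Kleene's partial recursive functions relative to an oracle.  In [Rec f g]
   the recursion argument comes first; [g] receives the recursion index, the
   previous value and the parameters, in this order. *)
Inductive code : Type :=
| Zero
| Succ
| Proj of nat
| Oracle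
| Comp of code & seq code
| Rec of code & code
| Mu of code.

Inductive eval (p : baire) : code -> seq nat -> nat -> Prop :=
| eval_Zero xs : eval p Zero xs 0%N
| eval_Succ x xs : eval p Succ (x :: xs) x.+1
| eval_Proj i xs : (i < size xs)%N -> eval p (Proj i) xs (nth 0%N xs i)
| eval_Oracle x xs : eval p Oracle (x :: xs) (p x)
| eval_Comp f gs xs ys z :
    List.Forall2 (fun g y => eval p g xs y) gs ys ->
    eval p f ys z -> eval p (Comp f gs) xs z
| eval_Rec0 f g xs y :
    eval p f xs y -> eval p (Rec f g) (0%N :: xs) y
| eval_RecS f g n xs y z :
    eval p (Rec f g) (n :: xs) y -> eval p g (n :: y :: xs) z ->
    eval p (Rec f g) (n.+1 :: xs) z
| eval_Mu f n xs :
    (forall m, (m < n)%N -> exists k, eval p f (m :: xs) k.+1) ->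
    eval p f (n :: xs) 0%N -> eval p (Mu f) xs n.

Record partial_fun (A B : Type) : Type := PartialFun {
  graph :> A -> B -> Prop;
  graph_functional : forall a b b', graph a b -> graph a b' -> b = b' }.

Lemma pcomp_functional (A B C : Type)
    (G : partial_fun B C) (F : partial_fun A B) (a : A) (c c' : C) :
  (exists2 b, F a b & G b c) -> (exists2 b, F a b & G b c') -> c = c'.
Proof.
move=> [b Fab Gbc] [b' Fab' Gbc'].
rewrite (graph_functional Fab' Fab) in Gbc'; exact: graph_functional Gbc Gbc'.
Qed.

Definition pcomp (A B C : Type) (G : partial_fun B C) (F : partial_fun A B) :
    partial_fun A C :=
  PartialFun (@pcomp_functional A B C G F).

(* As usual in computable analysis, nothing is required of the program on
   oracles outside the domain of [F]. *)
Definition computable (F : partial_fun baire baire) : Prop :=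
  exists e : code, forall p q, F p q -> forall n, eval p e [:: n] (q n).

Record representation (X : Type) : Type := Representation {
  rep :> partial_fun baire X;
  rep_surjective : forall x, exists p, rep p x }.

(* A partial multi-valued function between represented spaces; its domain is
   the set of [x] such that [values x] is non-empty. *)
Record problem : Type := Problem {
  input : Type;
  output : Type;
  input_rep : representation input;
  output_rep : representation output;
  values : input -> set output }.

Definition realizes (F : partial_fun baire baire) (f : problem) : Prop :=
  forall p x, input_rep f p x -> values x !=set0 ->
    exists q y, [/\ F p q, output_rep f q y & values x y].

Definition sW_le (f g : problem) : Prop :=
  exists H K : partial_fun baire baire,
    [/\ computable H, computable K &
        forall G, realizes G g -> realizes (pcomp H (pcomp G K)) f].

Definition sW_equiv (f g : problem) : Prop := sW_le f g /\ sW_le g f.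

Definition dist (p q : baire) : R :=
  if pselect (exists i, p i != q i) is left neq_pq then 2^-1 ^+ ex_minn neq_pq
  else 0.

Definition converges (s : nat -> baire) (x : baire) : Prop :=
  forall e : R, 0 < e ->
    exists N, forall n, (N <= n)%N -> dist (s n) x < e.

Definition cluster_point (s : nat -> baire) (x : baire) : Prop :=
  forall e : R, 0 < e ->
    forall N, exists2 n, (N <= n)%N & dist (s n) x < e.

Definition open_set (U : set baire) : Prop :=
  forall x, U x -> exists2 e : R, 0 < e & forall y, dist x y < e -> U y.

Definition closed_subset : Type := {A : set baire | open_set (~` A)}.

(* [alpha (pairing a i)] is [a] followed by [alpha i]; since [pairing 0 0 = 0],
   [alpha 0] is the zero sequence. *)
Definition alpha (i : nat) : baire :=
  fun n => (unpairing (iter n (fun m => (unpairing m).2) i)).1.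

Definition nonneg_rat (k : nat) : rat :=
  (unpairing k).1%:R / (unpairing k).2.+1%:R.

Definition basic_ball (n : nat) : set baire :=
  [set x | dist (alpha (unpairing n).1) x < ratr (nonneg_rat (unpairing n).2)].

Lemma alphaS a i n : alpha (pairing a i) n.+1 = alpha i n.
Proof. by rewrite /alpha iterSr pairingK. Qed.

Lemma alpha_pairing0 a i : alpha (pairing a i) 0%N = a.
Proof. by rewrite /alpha /= pairingK. Qed.

Lemma alpha_prefix (x : baire) n :
  exists i, forall j, (j < n)%N -> alpha i j = x j.
Proof.
elim: n x => [|n IHn] x; first by exists 0%N.
have [i ix] := IHn (fun j => x j.+1).
exists (pairing (x 0%N) i) => -[|j] jn; first exact: alpha_pairing0.
by rewrite alphaS ix.
Qed.

Lemma alpha_eventually0 i : exists N, forall n, (N <= n)%N -> alpha i n = 0%N.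
Proof.
have alpha0 n : alpha 0 n = 0%N.
  by elim: n => // n IHn; exact: etrans (alphaS 0 0 n) IHn.
elim/ltn_ind: i => -[|i] IH; first by exists 0%N => n _; exact: alpha0.
have lt_i : ((unpairing i.+1).2 < i.+1)%N.
  have := unpairingK i.+1; case: (unpairing i.+1) => a [//|b] /= <-.
  by rewrite /pairing /Cantor.to_nat plusE -[X in (X < _)%N]addn0 ltn_add2l.
have [N HN] := IH _ lt_i; exists N.+1 => -[//|n] Nn.
by rewrite -(unpairingK i.+1) alphaS HN.
Qed.

Lemma dist_lt_exp (p q : baire) k :
  dist p q < 2^-1 ^+ k <-> forall i, (i <= k)%N -> p i = q i.
Proof.
have h0 : (0 : R) < 2^-1 by rewrite invr_gt0.
have h1 : (2^-1 : R) < 1 by rewrite invf_lt1 // ltr1n.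
rewrite /dist; case: pselect => [neq_pq|eq_pq].
  case: ex_minnP => m pqm min_m; rewrite ltr_iXn2l //; split=> [km i ik|pq].
    by apply/eqP/negPn/negP => /min_m; rewrite leqNgt (leq_ltn_trans ik).
  by rewrite ltnNge; apply/negP => /pq /eqP; apply/negP.
split=> [_ i _|_]; last by rewrite exprn_gt0.
by apply/eqP/negPn/negP => pqi; apply: eq_pq; exists i.
Qed.

Lemma distxx p : dist p p = 0.
Proof.
by rewrite /dist; case: pselect => // neq; exfalso; case: neq => i; rewrite eqxx.
Qed.

Lemma exp_half_lt (e : R) : 0 < e -> exists k, 2^-1 ^+ k < e.
Proof.
move=> e0; exists (Num.bound e^-1).
rewrite exprVn invf_plt ?posrE ?exprn_gt0 //.
apply: lt_trans (archi_boundP _) _; first by rewrite invr_ge0 ltW.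
by rewrite -natrX ltr_nat ltn_expl.
Qed.

Lemma baire_rep_functional (p x y : baire) : p = x -> p = y -> x = y.
Proof. by move=> ->. Qed.

Lemma baire_rep_surjective (x : baire) : exists p, p = x.
Proof. by exists x. Qed.

Definition baire_rep : representation baire :=
  @Representation _ (PartialFun baire_rep_functional) baire_rep_surjective.

(* <p_0, p_1, ...> *)
Definition tupling (s : nat -> baire) : baire :=
  fun n => s (unpairing n).1 (unpairing n).2.

Lemma tuplingE s i j : tupling s (pairing i j) = s i j.
Proof. by rewrite /tupling pairingK. Qed.

Lemma seq_rep_functional p (s t : nat -> baire) :
  p = tupling s -> p = tupling t -> s = t.
Proof.
by move=> -> st; apply/funext => i; apply/funext => j; rewrite -(tuplingE s) st tuplingE.
Qed.

Lemma seq_rep_surjective (s : nat -> baire) : exists p, p = tupling s.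
Proof. by exists (tupling s). Qed.

Definition seq_rep : representation (nat -> baire) :=
  @Representation _ (PartialFun seq_rep_functional) seq_rep_surjective.

Lemma psi_minus_functional (p : baire) (A B : closed_subset) :
  sval A = ~` (\bigcup_i basic_ball (p i)) ->
  sval B = ~` (\bigcup_i basic_ball (p i)) -> A = B.
Proof.
case: A B => [A Ac] [B Bc] /= <- BA; case: A / BA Ac => Ac.
by congr exist; exact: Prop_irrelevance.
Qed.

Lemma psi_minus_surjective (A : closed_subset) :
  exists p : baire, sval A = ~` (\bigcup_i basic_ball (p i)).
Proof.
case: A => A Aclosed /=.
pose p n := if `[< basic_ball n `<=` ~` A >] then n else 0%N.
have ball0 : basic_ball 0 = set0.
  apply/seteqP; split=> // x; rewrite /basic_ball /nonneg_rat /= mul0r rmorph0.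
  by rewrite /dist; case: pselect => [h|_]; rewrite ?ltxx // ltNge exprn_ge0 ?invr_ge0.
exists p; apply/seteqP; split=> x /=.
  move=> Ax [n _]; rewrite /p; case: asboolP => [sub /sub //|_].
  by rewrite ball0.
apply: contra_notP => /Aclosed [e e0 eA].
have [k ke] := exp_half_lt e0.
have [i ix] := alpha_prefix x k.+1.
pose n := pairing i (pairing 1 (2 ^ k).-1).
have ballE : basic_ball n = [set y | dist (alpha i) y < 2^-1 ^+ k].
  rewrite /basic_ball /nonneg_rat /n !pairingK /= prednK ?expn_gt0 //.
  by rewrite mul1r fmorphV /= ratr_nat exprVn natrX.
exists n => //; rewrite /p asboolT ?ballE.
  by apply/dist_lt_exp => j jk; exact: ix.
move=> y /dist_lt_exp iy; apply: eA; apply: lt_trans ke.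
by apply/dist_lt_exp => j jk; rewrite -ix // iy.
Qed.

Lemma basic_ball_open n : open_set (basic_ball n).
Proof.
rewrite /basic_ball; move: (alpha _) (ratr _) => a r x /= axr.
have half0 k : (0 : R) < 2^-1 ^+ k by rewrite exprn_gt0 // invr_gt0.
have [[i axi]|ax] := pselect (exists i, a i != x i); last first.
  have {}ax : a = x.
    by apply/funext => i; apply/eqP/negPn/negP => axi; apply: ax; exists i.
  rewrite ax distxx in axr *; have [k kr] := exp_half_lt axr.
  by exists (2^-1 ^+ k) => // y /lt_trans; apply.
exists (2^-1 ^+ i) => // y /dist_lt_exp xy; apply: le_lt_trans axr.
rewrite leNgt; apply/negP; rewrite {1}/dist; case: pselect => [neq|[]]; last by exists i.
case: ex_minnP => m axm min_m.
have mi : (m <= i)%N := min_m _ axi.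
have aym : a m != y m by rewrite -xy.
rewrite /dist; case: pselect => [neq'|/= _]; last by rewrite ltNge ltW.
case: ex_minnP => m' aym' min_m'; have m'm := min_m' _ aym.
have /min_m mm' : a m' != x m' by rewrite xy // (leq_trans m'm).
by rewrite (@anti_leq m m') ?ltxx // mm'.
Qed.

Lemma psi_minus_total (p : baire) :
  exists A : closed_subset, sval A = ~` (\bigcup_i basic_ball (p i)).
Proof.
have Uopen : open_set (~` ~` (\bigcup_i basic_ball (p i))).
  rewrite setCK => x [i _ /basic_ball_open[e e0 eU]].
  by exists e => // y /eU ?; exists i.
by exists (exist (fun A => open_set (~` A)) _ Uopen).
Qed.

Definition psi_minus : representation closed_subset :=
  @Representation _ (PartialFun psi_minus_functional) psi_minus_surjective.

Lemma converges_unique s x y : converges s x -> converges s y -> x = y.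
Proof.
move=> sx sy; apply/funext => k.
have h0 : (0 : R) < 2^-1 ^+ k by rewrite exprn_gt0 // invr_gt0.
have [N sxN] := sx _ h0; have [M syM] := sy _ h0.
have /dist_lt_exp <- // := sxN _ (leq_maxl N M).
by have /dist_lt_exp -> := syM _ (leq_maxr N M).
Qed.

Lemma lim_functional (p x y : baire) :
  (exists2 s, p = tupling s & converges s x) ->
  (exists2 s, p = tupling s & converges s y) -> x = y.
Proof.
move=> [s ps sx] [t pt ty]; apply: (converges_unique sx).
by rewrite (seq_rep_functional ps pt).
Qed.

Definition lim : partial_fun baire baire := PartialFun lim_functional.

Lemma rep_lim_surjective (X : Type) (delta : representation X) (x : X) :
  exists p, pcomp delta lim p x.
Proof.
have [q qx] := rep_surjective delta x.
exists (tupling (fun _ => q)), q => //; exists (fun _ => q) => // e e0.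
by exists 0%N => n _; rewrite distxx.
Qed.

Definition rep_lim (X : Type) (delta : representation X) : representation X :=
  Representation (rep_lim_surjective delta).

Definition derivative (f : problem) : problem :=
  Problem (rep_lim (input_rep f)) (output_rep f) (@values f).

Definition closed_choice : problem :=
  Problem psi_minus baire_rep (fun A => sval A).

Definition cluster_problem : problem :=
  Problem seq_rep baire_rep cluster_point.

(* Main.v *)
From Stdlib Require Cantor.
From mathcomp Require Import all_boot all_order all_algebra zify.
From mathcomp Require Import boolp classical_sets reals Rstruct.
Require Import Defs.

(** Closed choice absorbs the quantifiers of the other two problems by choosing
    witnesses along with the point: a cluster point together with indices at
    which the sequence approximates it, and a point of the limit set together
    with a modulus of convergence of its names, both range over sets that are
    closed uniformly in the input. Conversely the points of a closed set are the
    cluster points of a sequence that lists, each infinitely often, the words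
    not yet seen to lie in the complement. *)

Set Implicit Arguments.
Unset Strict Implicit.
Unset Printing Implicit Defensive.

Import Order.TTheory GRing.Theory Num.Theory.

Local Open Scope classical_set_scope.

(** * Relativised computation and composition of reductions *)

(** [Oracle] reads only the first of its arguments, while [d] is run on a one-element list, hence
    [Proj 0]. *)
Fixpoint oracle_subst (d c : code) : code :=
  match c with
  | Oracle => Comp d [:: Proj 0]
  | Comp f gs => Comp (oracle_subst d f) (map (oracle_subst d) gs)
  | Rec f g => Rec (oracle_subst d f) (oracle_subst d g)
  | Mu f => Mu (oracle_subst d f)
  | _ => c
  end.

Lemma eval_oracle_subst (p q : baire) (d : code) :
  (forall n, eval p d [:: n] (q n)) ->
  forall c xs y, eval q c xs y -> eval p (oracle_subst d c) xs y.
Proof.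
(* Recursion on the derivation reaches the premises nested in [List.Forall2] and under [exists]. *)
move=> dq; fix IH 4 => c xs y; case.
- by move=> xs'; constructor.
- by move=> x xs'; constructor.
- by move=> i xs' ilt; exact: eval_Proj.
- move=> x xs'; apply: (eval_Comp (ys := [:: x])); last exact: dq.
  by constructor=> //; exact: (@eval_Proj p 0 (x :: xs')).
- move=> f gs xs' ys z gsP fP; apply: (eval_Comp (ys := ys)); last exact: IH fP.
  elim: gsP => [|g y' gs' ys' gy _ IHl] /=; first exact: List.Forall2_nil.
  by apply: List.Forall2_cons => //; exact: IH gy.
- by move=> f g xs' y' fP; apply: eval_Rec0; exact: IH fP.
- move=> f g n xs' y' z recP gP.
  by apply: (eval_RecS (y := y')); [exact: (IH (Rec f g)) recP|exact: IH gP].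
- move=> f n xs' lt_n eq_n; apply: eval_Mu => [m mn|]; last exact: IH eq_n.
  by case: (lt_n m mn) => k kP; exists k; exact: IH kP.
Qed.

Lemma computable_pcomp (G F : partial_fun baire baire) :
  computable G -> computable F -> computable (pcomp G F).
Proof.
move=> [c cP] [d dP]; exists (oracle_subst d c) => p r [q Fpq Gqr] n.
by apply: (eval_oracle_subst (dP _ _ Fpq)); exact: cP.
Qed.

Lemma sW_le_trans f g h : sW_le f g -> sW_le g h -> sW_le f h.
Proof.
move=> [H1 [K1 [cH1 cK1 fg]]] [H2 [K2 [cH2 cK2 gh]]].
exists (pcomp H1 H2), (pcomp K2 K1); split; try exact: computable_pcomp.
move=> G /gh /fg GP p x px xne; have [q [y [Fpq qy xy]]] := GP p x px xne.
exists q, y; split=> //; case: Fpq => b [a pa [b' [a' aa' a'b'] b'b] bq].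
by exists b' => //=; [exists a' => //; exists a|exists b].
Qed.

(** * Computable functionals of an oracle and an environment *)

Definition env : Type := nat -> nat.

(* Functionals of an oracle and finitely many numerical arguments, the latter
   being read off an environment of which only a prefix matters. *)
Definition orec (F : baire -> env -> nat) : Prop :=
  exists e k, forall p v n, k <= n -> eval p e (mkseq v n) (F p v).

Lemma orec_ext F G : (forall p v, F p v = G p v) -> orec F -> orec G.
Proof. by move=> FG [e [k eP]]; exists e, k => p v n kn; rewrite -FG; exact: eP. Qed.

Lemma orec_var i : orec (fun _ v => v i).
Proof.
exists (Proj i), i.+1 => p v n ilt.
by rewrite -(nth_mkseq 0 v ilt); apply: eval_Proj; rewrite size_mkseq.
Qed.

Lemma eval_projs p (v : env) n s : all (fun i => i < n) s ->
  List.Forall2 (fun g y => eval p g (mkseq v n) y) (map Proj s) (map v s).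
Proof.
elim: s => [|i s IH] /=; first by constructor.
move=> /andP[ilt /IH {}IH]; constructor=> //.
rewrite -[X in eval _ _ _ X](nth_mkseq 0 v ilt); apply: eval_Proj.
by rewrite size_mkseq.
Qed.

Lemma orec_rename (s : nat -> nat) F : orec F -> orec (fun p v => F p (fun i => v (s i))).
Proof.
move=> [e [k eP]]; exists (Comp e (map Proj (mkseq s k))).
(* The prefix must contain the images of all [k] variables that [e] reads. *)
exists (\max_(i < k) s i).+1 => p v n kn.
apply: (eval_Comp (ys := mkseq (v \o s) k)); last exact: eP.
rewrite /mkseq map_comp; apply/eval_projs/allP => j /mapP[i]; rewrite mem_iota /= add0n => ik ->.
by apply: leq_trans kn; rewrite ltnS; exact: (leq_bigmax (F := fun i : 'I_k => s i) (Ordinal ik)).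
Qed.

Lemma orec_codes (As : seq (baire -> env -> nat)) : List.Forall orec As ->
  exists gs k, forall p v n, k <= n ->
    List.Forall2 (fun g y => eval p g (mkseq v n) y) gs [seq A p v | A <- As].
Proof.
elim=> [|A As' [e [k eP]] _ [gs [k' gsP]]]; first by exists [::], 0; constructor.
exists (e :: gs), (maxn k k') => p v n; rewrite geq_max => /andP[kn k'n].
by constructor; [exact: eP|exact: gsP].
Qed.

Lemma orec_app F (As : seq (baire -> env -> nat)) : orec F -> List.Forall orec As ->
  orec (fun p v => F p (nth 0 [seq A p v | A <- As])).
Proof.
move=> [e [k eP]] /orec_codes[gs [k' gsP]].
(* [e] may expect more arguments than [As] supplies; padding with [Zero] reproduces the default 0 of
   [nth]. *)
exists (Comp e (gs ++ nseq k Zero)), k' => p v n k'n.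
set ys := [seq A p v | A <- As].
apply: (eval_Comp (ys := mkseq (nth 0 ys) (size ys + k))); last first.
  by apply: eP; rewrite leq_addl.
have -> : mkseq (nth 0 ys) (size ys + k) = ys ++ nseq k 0.
  apply: (@eq_from_nth _ 0) => [|i]; rewrite size_mkseq ?size_cat ?size_nseq // => ilt.
  rewrite nth_mkseq // nth_cat; case: ltnP => // le_i.
  by rewrite nth_nseq if_same nth_default.
apply: List.Forall2_app; first exact: gsP.
by elim: k {eP} => [|k IH] /=; constructor=> //; constructor.
Qed.

Lemma orec_app1 (f : baire -> nat -> nat) A :
  orec (fun p v => f p (v 0)) -> orec A -> orec (fun p v => f p (A p v)).
Proof.
by move=> fP AP; apply: (orec_app (As := [:: A]) fP); do ! constructor.
Qed.

Lemma orec_app2 (f : baire -> nat -> nat -> nat) A B :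
  orec (fun p v => f p (v 0) (v 1)) -> orec A -> orec B ->
  orec (fun p v => f p (A p v) (B p v)).
Proof.
by move=> fP AP BP; apply: (orec_app (As := [:: A; B]) fP); do ! constructor.
Qed.

Lemma orec_oracle A : orec A -> orec (fun p v => p (A p v)).
Proof.
by apply: (@orec_app1 (fun p n => p n)); exists Oracle, 1 => p v [|n] // _; constructor.
Qed.

Lemma orec_succ A : orec A -> orec (fun p v => (A p v).+1).
Proof.
by apply: (@orec_app1 (fun p n => n.+1)); exists Succ, 1 => p v [|n] // _; constructor.
Qed.

Lemma orec_const c : orec (fun _ _ => c).
Proof.
elim: c => [|c IH]; last exact: orec_succ.
by exists Zero, 0 => p v n _; constructor.
Qed.

Lemma orec_rec N B (S : baire -> nat -> nat -> env -> nat) :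
  orec N -> orec B -> orec (fun p v => S p (v 0) (v 1) (fun i => v i.+2)) ->
  orec (fun p v => nat_rect (fun _ => nat) (B p v) (fun m y => S p m y v) (N p v)).
Proof.
move=> [eN [kN NP]] [eB [kB BP]] [eS [kS SP]].
pose k := maxn kN (maxn kB kS).
(* A code cannot forward a list of unknown length, so exactly the first [k] parameters are passed
   on. *)
exists (Comp (Rec eB eS) (eN :: map Proj (iota 0 k))), k => p v n kn.
have [kNn kBk kSk] : [/\ kN <= n, kB <= k & kS <= k].
  by rewrite (leq_trans _ kn) /k !leq_max ?leqnn ?orbT.
apply: (eval_Comp (ys := N p v :: mkseq v k)).
  constructor; first exact: NP.
  by apply/eval_projs/allP => i; rewrite mem_iota => /leq_trans; apply.
elim: (N p v) => [|m IH] /=; first by apply: eval_Rec0; exact: BP.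
apply: eval_RecS IH _; set y := nat_rect _ _ _ _.
pose w i := if i is i'.+1 then if i' is i''.+1 then v i'' else y else m.
have -> : [:: m, y & mkseq v k] = mkseq w k.+2.
  by rewrite /mkseq /= (iotaDl 2 0) -map_comp.
by apply: (SP p w); rewrite ltnW // ltnW.
Qed.

Lemma computable_orec (f : baire -> baire) (F : partial_fun baire baire) :
  orec (fun p v => f p (v 0)) -> (forall p q, F p q -> q = f p) -> computable F.
Proof.
(* [e] is reliable only on at least [k] arguments, so the single input is repeated: it runs in a
   constant environment. *)
move=> [e [k eP]] Ff; exists (Comp e (mkseq (fun=> Proj 0) k.+1)) => p q /Ff -> n.
apply: (eval_Comp (ys := mkseq (fun=> n) k.+1)); last by apply: (eP p (fun=> n)); lia.
rewrite /mkseq; elim: (iota 0 k.+1) => [|i s IH] /=; constructor=> //.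
exact: (@eval_Proj p 0 [:: n]).
Qed.


(* Arithmetic, bounded quantifiers and pairing *)
Create HintDb orec discriminated.
#[local] Hint Resolve orec_var orec_const orec_succ orec_oracle : orec.

Definition orecb (P : baire -> env -> bool) : Prop := orec (fun p v => nat_of_bool (P p v)).

(** Allows a function to be recognised by its recursion equations instead of being displayed as a
    [nat_rect]. *)
Lemma orec_rec_ext F N B (S : baire -> nat -> nat -> env -> nat) :
  orec N -> orec B -> orec (fun p v => S p (v 0) (v 1) (fun i => v i.+2)) ->
  (forall p v, F p v 0 = B p v) -> (forall p v m, F p v m.+1 = S p m (F p v m) v) ->
  orec (fun p v => F p v (N p v)).
Proof.
move=> NP BP SP F0 FS; apply: orec_ext (orec_rec NP BP SP) => p v.
by elim: (N p v) => [|m IH] /=; rewrite ?F0 ?FS ?IH.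
Qed.

Lemma orec_add A B : orec A -> orec B -> orec (fun p v => A p v + B p v).
Proof.
move=> AP BP; apply: (orec_rec_ext (F := fun p v b => A p v + b)
  (S := fun _ _ y _ => y.+1) BP AP); auto with orec => p v *; lia.
Qed.

Lemma orec_mul A B : orec A -> orec B -> orec (fun p v => A p v * B p v).
Proof.
apply: (@orec_app2 (fun _ a b => a * b)).
apply: (orec_rec_ext (F := fun p v b => v 0 * b) (B := fun _ _ => 0)
  (S := fun _ _ y v => y + v 0)); auto using orec_add with orec => p v *; lia.
Qed.

Lemma orec_pred A : orec A -> orec (fun p v => (A p v).-1).
Proof.
move=> AP; apply: (orec_rec_ext (F := fun p v b => b.-1) (B := fun _ _ => 0)
  (S := fun _ m _ _ => m)); auto with orec.
Qed.

Lemma orec_sub A B : orec A -> orec B -> orec (fun p v => A p v - B p v).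
Proof.
move=> AP BP; apply: (orec_rec_ext (F := fun p v b => A p v - b)
  (S := fun _ _ y _ => y.-1) BP AP); auto using orec_pred with orec => p v *; lia.
Qed.

Lemma orec_exp2 A : orec A -> orec (fun p v => 2 ^ A p v).
Proof.
move=> AP; apply: (orec_rec_ext (F := fun p v b => 2 ^ b) (B := fun _ _ => 1)
  (S := fun _ _ y _ => 2 * y)); auto using orec_mul with orec => p v *; exact: expnS.
Qed.

Lemma orecb_leq A B : orec A -> orec B -> orecb (fun p v => A p v <= B p v).
Proof.
move=> AP BP; apply: (@orec_ext (fun p v => 1 - (A p v - B p v))) => [p v|]; first lia.
by apply: orec_sub; auto using orec_sub with orec.
Qed.

Lemma orecb_and P Q : orecb P -> orecb Q -> orecb (fun p v => P p v && Q p v).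
Proof. by move=> PP QP; apply: orec_ext (orec_mul PP QP) => p v; rewrite mulnb. Qed.

Lemma orecb_neg P : orecb P -> orecb (fun p v => ~~ P p v).
Proof.
move=> PP; apply: orec_ext (orec_sub (orec_const 1) PP) => p v.
by case: (P p v).
Qed.

Lemma orecb_implb P Q : orecb P -> orecb Q -> orecb (fun p v => P p v ==> Q p v).
Proof.
move=> PP QP; apply: orec_ext (orecb_neg (orecb_and PP (orecb_neg QP))) => p v.
by case: (P p v); case: (Q p v).
Qed.

Lemma orecb_eq A B : orec A -> orec B -> orecb (fun p v => A p v == B p v).
Proof.
move=> AP BP; apply: orec_ext (orecb_and (orecb_leq AP BP) (orecb_leq BP AP)) => p v.
by rewrite eqn_leq.
Qed.

Lemma orec_if P A B : orecb P -> orec A -> orec B ->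
  orec (fun p v => if P p v then A p v else B p v).
Proof.
move=> PP AP BP.
apply: orec_ext (orec_add (orec_mul PP AP) (orec_mul (orecb_neg PP) BP)) => p v.
by case: (P p v); rewrite /= !mul0n !mul1n ?addn0.
Qed.

Lemma orecb_all N (Q : baire -> nat -> env -> bool) :
  orec N -> orecb (fun p v => Q p (v 0) (fun i => v i.+1)) ->
  orecb (fun p v => all (fun m => Q p m v) (iota 0 (N p v))).
Proof.
(* In a recursion step, slot 1 holds the previous value, which [Q] has to skip. *)
move=> NP /(orec_rename (fun i => if i is i'.+1 then i'.+2 else 0)) QP.
apply: (orec_rec_ext (F := fun p v b => nat_of_bool (all (fun m => Q p m v) (iota 0 b)))
  (B := fun _ _ => 1) (S := fun p m y v => y * Q p m v)) => //.
- exact: orec_const.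
- by apply: orec_mul QP; exact: orec_var.
- by move=> p v m; rewrite -addn1 iotaD all_cat add0n /= andbT mulnb.
Qed.

#[local] Hint Resolve orec_add orec_mul orec_pred orec_sub orec_exp2 orecb_leq
  orecb_and orecb_neg orecb_implb orecb_eq orec_if orecb_all : orec.

Lemma pairing_bounds i j : i <= pairing i j /\ j <= pairing i j.
Proof. by have := Cantor.to_nat_spec i j; rewrite -/(pairing i j); nia. Qed.

Lemma orec_pairing A B : orec A -> orec B -> orec (fun p v => pairing (A p v) (B p v)).
Proof.
move=> AP BP; apply: (@orec_add B) => //.
apply: (@orec_rec (fun p v => B p v + A p v) (fun _ _ => 0) (fun _ m y _ => m.+1 + y));
  auto with orec.
Qed.

#[local] Hint Resolve orec_pairing : orec.

(** Bounded search, used to invert the pairing: the recursion stores the unique solution when it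
    meets it. *)
Lemma orec_find N (Q : baire -> nat -> env -> bool) F :
  orec N -> orecb (fun p v => Q p (v 0) (fun i => v i.+2)) ->
  (forall p v m, m < N p v -> Q p m v = (m == F p v)) ->
  (forall p v, F p v < N p v) ->
  orec F.
Proof.
move=> NP QP QF FN; apply: orec_ext (@orec_rec N (fun _ _ => 0)
  (fun p m y v => if Q p m v then m else y) NP _ _); auto with orec => p v.
have : forall m, m <= N p v -> nat_rect (fun=> nat) 0
    (fun m y => if Q p m v then m else y) m = if F p v < m then F p v else 0.
  elim=> [//|m IH] mN /=; rewrite (QF _ _ _ mN) IH ?(ltnW mN) // ltnS.
  by case: ltngtP => // ->.
by move=> -> //; rewrite FN.
Qed.

Lemma unpairing_le n : (unpairing n).1 <= n /\ (unpairing n).2 <= n.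
Proof. by rewrite -{2 4}(unpairingK n); exact: pairing_bounds. Qed.

Lemma pairing_eq i j n : (pairing i j == n) = (i == (unpairing n).1) && (j == (unpairing n).2).
Proof.
apply/eqP/andP => [<-|[/eqP-> /eqP->]]; last exact: unpairingK.
by rewrite pairingK.
Qed.

Lemma orec_unpairing1 A : orec A -> orec (fun p v => (unpairing (A p v)).1).
Proof.
apply: (@orec_app1 (fun _ n => (unpairing n).1)).
(* Both components of a code are at most the code, so a bounded existential over the second one
   suffices. *)
apply: (@orec_find (fun _ v => (v 0).+1) (fun _ m v =>
    ~~ all (fun y => ~~ (pairing m y == v 0)) (iota 0 (v 0).+1))) => [||p v|p v].
- by auto with orec.
- apply: orecb_neg; apply: (@orecb_all _ (fun _ y v => ~~ (pairing (v 0) y == v 2)));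
    auto with orec.
- move=> m mn; rewrite -has_predC; apply/hasP/eqP => [[y _ /=]|->].
    by rewrite negbK pairing_eq => /andP[/eqP].
  exists (unpairing (v 0)).2; last by rewrite /= negbK unpairingK.
  by rewrite mem_iota ltnS; case: (unpairing_le (v 0)).
- by rewrite ltnS; case: (unpairing_le (v 0)).
Qed.

Lemma orec_unpairing2 A : orec A -> orec (fun p v => (unpairing (A p v)).2).
Proof.
apply: (@orec_app1 (fun _ n => (unpairing n).2)).
apply: (@orec_find (fun _ v => (v 0).+1) (fun _ m v => pairing (unpairing (v 0)).1 m == v 0))
  => [||p v|p v]; try by auto using orec_unpairing1 with orec.
- by move=> m mn; rewrite pairing_eq eqxx.
- by rewrite ltnS; case: (unpairing_le (v 0)).
Qed.

#[local] Hint Resolve orec_unpairing1 orec_unpairing2 : orec.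

(** * Basic balls and finite words *)

Lemma orec_alpha A B : orec A -> orec B -> orec (fun p v => alpha (A p v) (B p v)).
Proof.
move=> AP BP; apply: orec_unpairing1.
apply: (orec_rec_ext (F := fun p v b => iter b (fun m => (unpairing m).2) (A p v))
  (B := A) (S := fun _ _ y _ => (unpairing y).2)); auto with orec.
Qed.

#[local] Hint Resolve orec_alpha : orec.

(* Whether the word [z 0 .. z l.-1] forces membership in ball [b], whose centre
   [a] and radius [u / v.+1] admit exactly the [x] with [x m = a m] whenever
   [2 ^- m >= u / v.+1]; as [u > 0], such [m] are at most [v]. *)
Definition word_in_ball (b : nat) (z : baire) (l : nat) : bool :=
  let u := (unpairing (unpairing b).2).1 in
  let v := (unpairing (unpairing b).2).2 in
  (0 < u) && all (fun m => (u * 2 ^ m <= v.+1) ==>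
    ((m < l) && (alpha (unpairing b).1 m == z m))) (iota 0 v.+1).

(** If [m] is the first difference from the centre, [2 ^- m < u / v.+1] says [v.+1 < u * 2 ^ m]; so
    agreement is required exactly where this fails. For the centre itself only [0 < u] remains. *)
Lemma basic_ballP b x :
  let u := (unpairing (unpairing b).2).1 in
  let v := (unpairing (unpairing b).2).2 in
  basic_ball b x <->
  0 < u /\ forall m, u * 2 ^ m <= v.+1 -> alpha (unpairing b).1 m = x m.
Proof.
move=> u v; rewrite /basic_ball /nonneg_rat /= -/u -/v.
move: (alpha _) => a.
rewrite rmorphM /= fmorphV /= !ratr_nat ltr_pdivlMr ?ltr0n //.
rewrite /dist; case: pselect => [neq|eq_ax]; last first.
  rewrite mul0r ltr0n; split=> [u0|[]//]; split=> // m _.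
  by apply/eqP/negPn/negP => axm; apply: eq_ax; exists m.
case: ex_minnP => m axm min_m.
rewrite exprVn mulrC ltr_pdivrMr ?exprn_gt0 // -natrX -natrM ltr_nat.
split=> [vu|[u0 ax]].
  split=> [|m' m'v]; first by case: (u) vu.
  apply/eqP/negPn/negP => /min_m mm'.
  have : u * 2 ^ m <= u * 2 ^ m' by rewrite leq_mul2l leq_exp2l ?mm' ?orbT.
  by lia.
by rewrite ltnNge; apply: contra axm => /ax ->.
Qed.

Lemma word_in_ballP b z l :
  let u := (unpairing (unpairing b).2).1 in
  let v := (unpairing (unpairing b).2).2 in
  reflect (0 < u /\ forall m, u * 2 ^ m <= v.+1 -> m < l /\ alpha (unpairing b).1 m = z m)
    (word_in_ball b z l).
Proof.
move=> u v; apply: (iffP andP) => -[u0 H]; split=> //.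
  move=> m mv; move/allP: H => H; have : m \in iota 0 v.+1.
    rewrite mem_iota; have : m < 2 ^ m by exact: ltn_expl.
    by nia.
  by move=> /H; rewrite mv => /andP[-> /eqP].
by apply/allP => m _; apply/implyP => /H[-> ->] /=.
Qed.

Lemma word_in_ball_basic b z l x : word_in_ball b z l ->
  (forall m, m < l -> z m = x m) -> basic_ball b x.
Proof.
move=> /word_in_ballP[u0 H] zx; apply/basic_ballP; split=> // m /H[ml ->].
exact: zx.
Qed.

(** Only positions up to [v] are constrained, so a prefix of length [v.+1] is enough. *)
Lemma basic_word_in_ball b x : basic_ball b x -> exists l, word_in_ball b x l.
Proof.
move=> /basic_ballP[u0 H]; exists (unpairing (unpairing b).2).2.+1.
apply/word_in_ballP; split=> // m mv; split; last exact: H.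
by have : m < 2 ^ m by [exact: ltn_expl]; nia.
Qed.

Lemma word_in_ball_mono b z z' l l' : word_in_ball b z l -> l <= l' ->
  (forall m, m < l -> z m = z' m) -> word_in_ball b z' l'.
Proof.
move=> /word_in_ballP[u0 H] ll' zz'; apply/word_in_ballP; split=> // m /H[ml ->].
by split; [exact: leq_trans ll'|exact: zz'].
Qed.

(** The radius is [2 / 2 ^ l]; the factor 2 makes the strict inequality fix exactly the first [l]
    positions, including [l = 0]. *)
Definition cylinder (i l : nat) : nat := pairing i (pairing 2 (2 ^ l).-1).

Lemma basic_ball_cylinder i l x :
  basic_ball (cylinder i l) x <-> forall m, m < l -> alpha i m = x m.
Proof.
rewrite basic_ballP /cylinder !pairingK /= prednK ?expn_gt0 //.
by split=> [[_ H]|H]; [|split=> //] => m; move: (H m); rewrite -expnS leq_exp2l.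
Qed.

(** Code 0 has radius 0 and serves as a blank in enumerations of balls. *)
Lemma basic_ball0 x : ~ basic_ball 0 x.
Proof. by move=> /basic_ballP[]. Qed.

Lemma orecb_word_in_ball A (Z : baire -> nat -> env -> nat) L :
  orec A -> orec (fun p v => Z p (v 0) (fun i => v i.+1)) -> orec L ->
  orecb (fun p v => word_in_ball (A p v) (fun m => Z p m v) (L p v)).
Proof.
move=> AP ZP LP; rewrite /word_in_ball.
have AP' := orec_rename S AP; have LP' := orec_rename S LP.
apply: orecb_and; first by auto with orec.
apply: (@orecb_all _ (fun p m v =>
  (((unpairing (unpairing (A p v)).2).1 * 2 ^ m <= (unpairing (unpairing (A p v)).2).2.+1) ==>
    ((m < L p v) && (alpha (unpairing (A p v)).1 m == Z p m v)))));
  by auto 10 with orec.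
Qed.

(** * Names of closed sets cut out by local conditions *)

Definition enum_outside (P : baire -> nat -> bool) (u : nat -> nat) : baire :=
  fun n => if P (alpha (unpairing n).1) (unpairing n).2 then 0
           else cylinder (unpairing n).1 (u (unpairing n).2).

(** A violation of condition [c] persists on the cylinder of length [u c], which contains some
    [alpha i] at which it is detected. *)
Lemma enum_outsideP (P : baire -> nat -> bool) (u : nat -> nat) :
  (forall z z' c, (forall j, j < u c -> z j = z' j) -> P z c = P z' c) ->
  ~` (\bigcup_n basic_ball (enum_outside P u n)) = [set z | forall c, P z c].
Proof.
move=> Ploc; apply/seteqP; split=> z /=.
  move=> zN c; apply: contra_notT zN => Pzc.
  have [i iz] := alpha_prefix z (u c).
  exists (pairing i c) => //; rewrite /enum_outside pairingK /=.
  by rewrite (Ploc _ _ _ iz) (negbTE Pzc); apply/basic_ball_cylinder.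
move=> Pz [n _]; rewrite /enum_outside; case: ifPn => [_ /basic_ball0//|].
by move=> /negP nP /basic_ball_cylinder/Ploc eqP; apply: nP; rewrite eqP.
Qed.

Lemma total_fun_functional (f : baire -> baire) (p q q' : baire) :
  q = f p -> q' = f p -> q = q'.
Proof. by move=> -> ->. Qed.

Definition total_fun (f : baire -> baire) : partial_fun baire baire :=
  PartialFun (@total_fun_functional f).

(** Total translations of names suffice for the direct reductions below; [h] sees only the solution,
    as strong reducibility demands. *)
Lemma sW_le_total f g (h k : baire -> baire) :
  orec (fun p v => h p (v 0)) -> orec (fun p v => k p (v 0)) ->
  (forall p x, input_rep f p x -> values x !=set0 ->
    exists x', [/\ input_rep g (k p) x', values x' !=set0 &
      forall q y', output_rep g q y' -> values x' y' ->
        exists2 y, output_rep f (h q) y & values x y]) ->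
  sW_le f g.
Proof.
move=> hP kP fg; exists (total_fun h), (total_fun k).
split; [exact: (computable_orec hP)|exact: (computable_orec kP)|].
move=> G GP p x px xne; have [x' [kx' x'ne back]] := fg p x px xne.
have [q [y' [Gq qy' x'y']]] := GP _ _ kx' x'ne.
have [y hy xy] := back _ _ qy' x'y'.
by exists (h q), y; split=> //; exists q => //; exists (k p).
Qed.

(** * Cluster points and limits of names via closed choice *)

Lemma cluster_pointP s x :
  cluster_point s x <-> forall k N, exists2 n, N <= n & forall j, j < k -> s n j = x j.
Proof.
split=> [sx k N|sx e e0 N].
  have [|n Nn /dist_lt_exp snx] := sx (2^-1 ^+ k)%R _ N.
    by rewrite exprn_gt0 // invr_gt0.
  by exists n => // j /ltnW; exact: snx.
have [k ke] := exp_half_lt e0; have [n Nn snx] := sx k.+1 N.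
by exists n => //; apply: lt_trans ke; apply/dist_lt_exp => j; exact: snx.
Qed.

Lemma converges_at s x i : converges s x ->
  exists N, forall n, N <= n -> s n i = x i.
Proof.
move=> sx; have [|N HN] := sx (2^-1 ^+ i)%R; first by rewrite exprn_gt0 // invr_gt0.
by exists N => n /HN /dist_lt_exp; apply.
Qed.

Definition interleave (x m : baire) : baire :=
  fun n => if odd n then m n./2 else x n./2.

Lemma interleave_even x m j : interleave x m (j * 2) = x j.
Proof. by rewrite /interleave muln2 odd_double doubleK. Qed.

Lemma interleave_odd x m j : interleave x m (j * 2).+1 = m j.
Proof. by rewrite /interleave muln2 /= odd_double uphalf_double. Qed.

(* [z] interleaves a point [x] with indices [m k >= k] such that the
   [m k]-th member of the sequence coded by [p] agrees with [x] below [k]. *)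
Definition cluster_witness (p z : baire) (k : nat) : bool :=
  (k <= z (k * 2).+1) &&
  all (fun j => p (pairing (z (k * 2).+1) j) == z (j * 2)) (iota 0 k).

Lemma cluster_le_choice : sW_le cluster_problem closed_choice.
Proof.
(* The last position that condition [k] reads is [(k * 2).+1]. *)
pose u k := (k * 2).+2.
apply: (@sW_le_total _ _ (fun q n => q (n * 2)) (fun p => enum_outside (cluster_witness p) u)).
- by auto with orec.
- apply: orec_if; last by rewrite /cylinder /u; auto 20 with orec.
    apply: orecb_and; first by auto 20 with orec.
    apply: (@orecb_all _ (fun p j v => p (pairing
      (alpha (unpairing (v 0)).1 ((unpairing (v 0)).2 * 2).+1) j) ==
      alpha (unpairing (v 0)).1 (j * 2))); by auto 20 with orec.
  by auto with orec.
- move=> _ s /= -> [x /cluster_pointP sx].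
  have loc z z' c : (forall j, j < u c -> z j = z' j) ->
      cluster_witness (tupling s) z c = cluster_witness (tupling s) z' c.
    move=> zz'; rewrite /cluster_witness !zz' /u //; congr andb.
    by apply: eq_in_all => j; rewrite mem_iota => jc; rewrite zz' // /u; lia.
  have [A AE] := psi_minus_total (enum_outside (cluster_witness (tupling s)) u).
  exists A; split=> //; rewrite AE enum_outsideP //.
    have /choice[m mP] : forall k, exists n, k <= n /\ forall j, j < k -> s n j = x j.
      by move=> k; have [n] := sx k k; exists n.
    exists (interleave x m) => k; rewrite /cluster_witness interleave_odd.
    have [km mx] := mP k; rewrite km; apply/allP => j; rewrite mem_iota => jk.
    by rewrite interleave_even tuplingE mx.
  move=> q z -> zP; exists (fun n => z (n * 2)) => //; apply/cluster_pointP => k N.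
  (* This condition provides both an index beyond [N] and agreement below [k]. *)
  have /andP[kn /allP nz] := zP (k + N).
  exists (z ((k + N) * 2).+1); first by lia.
  by move=> j jk; rewrite -tuplingE; apply/eqP/nz; rewrite mem_iota; lia.
Qed.

(* [z] interleaves a point [x] with a modulus [m] of pointwise convergence of
   the sequence coded by [p]; [x] avoids every ball named by the limit. *)
Definition limit_witness (p z : baire) (c : nat) : bool :=
  let i := (unpairing c).1 in
  let n := (unpairing (unpairing c).2).1 in
  let m := z (i * 2).+1 in
  ((m <= n) ==> (p (pairing n i) == p (pairing m i))) &&
  ~~ word_in_ball (p (pairing m i)) (fun j => z (j * 2)) (unpairing (unpairing c).2).2.

Lemma word_in_ball_local b z z' l :
  (forall m, m < l -> z m = z' m) -> word_in_ball b z l = word_in_ball b z' l.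
Proof.
by move=> zz'; apply/idP/idP => /word_in_ball_mono; apply=> // m ml; rewrite zz'.
Qed.

Lemma choice'_le_choice : sW_le (derivative closed_choice) closed_choice.
Proof.
(* With [c] coding [(i, (n, l))], the condition reads position [(i * 2).+1] and the even positions
   below [l * 2]. *)
pose u c := (((unpairing c).1 + (unpairing (unpairing c).2).2) * 2).+2.
apply: (@sW_le_total _ _ (fun q n => q (n * 2)) (fun p => enum_outside (limit_witness p) u)).
- by auto with orec.
- apply: orec_if; last by rewrite /cylinder /u; auto 20 with orec.
    apply: orecb_and; first by auto 20 with orec.
    by apply: orecb_neg; apply: (@orecb_word_in_ball _
      (fun _ j v => alpha (unpairing (v 0)).1 (j * 2))); auto 20 with orec.
  by auto with orec.
- move=> _ B /= [q [s -> sq] BE] [x Bx].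
  have loc z z' c : (forall j, j < u c -> z j = z' j) ->
      limit_witness (tupling s) z c = limit_witness (tupling s) z' c.
    rewrite /u => zz'; rewrite /limit_witness !zz'; last by lia.
    by congr (_ && ~~ _); apply: word_in_ball_local => j jl; rewrite zz' //; lia.
  have [A AE] := psi_minus_total (enum_outside (limit_witness (tupling s)) u).
  exists A; split=> //; rewrite AE enum_outsideP //.
    have /choice[m mP] : forall i, exists N, forall n, N <= n -> s n i = q i.
      by move=> i; exact: converges_at.
    exists (interleave x m) => c; rewrite /limit_witness interleave_odd !tuplingE.
    rewrite (mP _ _ (leqnn _)); apply/andP; split.
      by apply/implyP => /mP ->.
    apply/negP => /word_in_ball_basic bx; move: Bx; rewrite BE; apply.
    exists (unpairing c).1 => //; apply: bx => j _; exact: interleave_even.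
  move=> r z -> zP; exists (fun n => z (n * 2)) => //; rewrite BE => -[i _].
  (* The claimed modulus is compared with a stage past both it and the actual point of
     convergence. *)
  have zq : s (z (i * 2).+1) i = q i.
    have [N HN] := converges_at i sq.
    have /andP[/implyP] := zP (pairing i (pairing (maxn N (z (i * 2).+1)) 0)).
    rewrite !pairingK /= !tuplingE leq_maxr => /(_ isT)/eqP <- _.
    by apply: HN; exact: leq_maxl.
  (* A ball containing the point is forced by a prefix of some length [l], which the condition for
     [l] excludes. *)
  rewrite -zq => /basic_word_in_ball[l zl].
  have /andP[_ /negP] := zP (pairing i (pairing 0 l)).
  by rewrite !pairingK /= tuplingE; apply.
Qed.

Lemma choice_le_choice' : sW_le closed_choice (derivative closed_choice).
Proof.
apply: (@sW_le_total _ _ id (fun p => tupling (fun=> p))); rewrite /tupling; auto with orec.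
move=> p A pA Ane; exists A; split=> //; last by move=> q y; exists y.
exists p => //; exists (fun=> p) => // e e0.
by exists 0 => n _; rewrite distxx.
Qed.

(** * Closed choice via cluster points *)

(** [n] codes a word, its length and a counter that makes the word recur at ever larger indices,
    where more balls are tested. *)
Definition unremoved (p : baire) (n : nat) : bool :=
  all (fun j => ~~ word_in_ball (p j) (alpha (unpairing n).1) (unpairing (unpairing n).2).1)
    (iota 0 n).

(* The value [n] past the word makes short words harmless: a cluster point
   can only come from words of unbounded length. *)
Definition survivors (p : baire) (n j : nat) : nat :=
  if unremoved p n && (j < (unpairing (unpairing n).2).1) then alpha (unpairing n).1 j else n.

(** Prefixes of a point outside all balls are never removed. Conversely, a point of a ball has a
    prefix forcing membership, and words extending it are removed at all large indices. *)
Lemma survivors_cluster p x : ~ (\bigcup_i basic_ball (p i)) x <->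
  cluster_point (survivors p) x.
Proof.
rewrite cluster_pointP; split=> [Ax k N|sx [i _ /basic_word_in_ball[l xl]]].
  have [i ix] := alpha_prefix x k; exists (pairing i (pairing k N)).
    by apply: leq_trans (pairing_bounds _ _).2; exact: (pairing_bounds _ _).2.
  move=> j jk; rewrite /survivors /unremoved !pairingK /= jk andbT.
  rewrite ifT ?ix //; apply/allP => t _; apply/negP => /word_in_ball_basic tx.
  by apply: Ax; exists t => //; exact: tx.
(* Beyond [i], the ball [p i] is tested; beyond the values [x 0 .. x l], the filler [n] cannot agree
   with [x]. Length [l.+1] keeps position 0 available when [l = 0]. *)
have [n nlarge nx] := sx l.+1 (i + \max_(j < l.+1) x j).+1.
have xlt j : j <= l -> x j < n.
  rewrite -ltnS => jl; apply: leq_trans nlarge; rewrite ltnS.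
  apply: leq_trans (leq_addl _ _).
  exact: (leq_bigmax (F := fun j : 'I_l.+1 => x j) (Ordinal jl)).
have [Un|Un] := boolP (unremoved p n); last first.
  by have := nx 0 isT; rewrite /survivors (negbTE Un) /=; have := xlt 0 isT; lia.
have [ll|ll] := leqP l (unpairing (unpairing n).2).1; last first.
  have := nx _ (leqW ll); rewrite /survivors ltnn andbF.
  by have := xlt _ (ltnW ll); lia.
have /allP/(_ i) := Un; rewrite mem_iota => /(_ _)/negP; case; first by lia.
apply: (word_in_ball_mono xl ll) => m ml.
by rewrite -nx ?ltnS ?(ltnW ml) // /survivors Un (leq_trans ml ll).
Qed.

Lemma choice_le_cluster : sW_le closed_choice cluster_problem.
Proof.
apply: (@sW_le_total _ _ id (fun p => tupling (survivors p))); first exact: (orec_oracle (orec_var 0)).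
  rewrite /tupling /survivors; apply: orec_if; try by auto 20 with orec.
  apply: orecb_and; last by auto 20 with orec.
  apply: (@orecb_all _ (fun p j v => ~~ word_in_ball (p j)
    (alpha (unpairing (unpairing (v 0)).1).1) (unpairing (unpairing (unpairing (v 0)).1).2).1)).
    by auto with orec.
  apply: orecb_neg; apply: (@orecb_word_in_ball _
    (fun _ m v => alpha (unpairing (unpairing (v 1)).1).1 m)); by auto 20 with orec.
move=> p A /= AE [x Ax]; exists (survivors p); split=> //.
  by exists x; apply/survivors_cluster; move: Ax; rewrite AE.
by move=> q y -> /survivors_cluster Ay; exists y => //; rewrite AE.
Qed.

Theorem theorem9p16 :
  sW_equiv cluster_problem (derivative closed_choice) /\
  sW_equiv (derivative closed_choice) closed_choice.
Proof.
split; split.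
- exact: sW_le_trans cluster_le_choice choice_le_choice'.
- exact: sW_le_trans choice'_le_choice choice_le_cluster.
- exact: choice'_le_choice.
- exact: choice_le_choice'.
Qed.
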